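(* Let $(\mathfrak{h},B_{\mathfrak{h}})$ be a real Lie algebra of compact type endowed with an $\mathrm{ad}_{\mathfrak{h}}$-invariant Euclidean product, and let $\mathfrak{m}$ be a faithful irreducible representation of $\mathfrak{h}$ over $\mathbb{R}$, endowed with an $\mathfrak{h}$-invariant Euclidean product $B_{\mathfrak{m}}$. If $(\Lambda^4\mathfrak{m})^{\mathfrak{h}}=0$, then $\mathfrak{m}$ is an $s$-representation of $(\mathfrak{h},B_{\mathfrak{h}})$.
   Context: A real Lie algebra of compact type means a finite-dimensional real Lie algebra admitting an $\mathrm{ad}$-invariant Euclidean (positive definite) product; it need not be semi-simple. For $a\in\mathfrak{h}$, $v\in\mathfrak{m}$, $av$ denotes the action of $a$ on $v$. An invariant Euclidean product $B_{\mathfrak{m}}$ satisfies $B_{\mathfrak{m}}(av,w)=-B_{\mathfrak{m}}(v,aw)$; by irreducibility it is used up to a positive constant. $(\Lambda^4\mathfrak{m})^{\mathfrak{h}}$ is the space of $\mathfrak{h}$-invariant elements of the fourth exterior power (over $\mathbb{R}$) of $\mathfrak{m}$. Definition ($s$-representation). On $\mathfrak{g}:=\mathfrak{h}\oplus\mathfrak{m}$ there is a unique skew-symmetric $\mathbb{R}$-bilinear bracket $[\cdot,\cdot]$ such that (1) its restriction to $\mathfrak{h}$ is the Lie bracket of $\mathfrak{h}$; (2) $[a,v]=-[v,a]=av$ for all $a\in\mathfrak{h}$, $v\in\mathfrak{m}$; (3) $[\mathfrak{m},\mathfrak{m}]\subset\mathfrak{h}$; (4) $B_{\mathfrak{h}}(a,[v,w])=B_{\mathfrak{m}}(av,w)$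 for all $a\in\mathfrak{h}$, $v,w\in\mathfrak{m}$. The irreducible representation $\mathfrak{m}$ is called an $s$-representation of $(\mathfrak{h},B_{\mathfrak{h}})$ if this bracket satisfies the Jacobi identity, i.e. defines a Lie algebra structure on $\mathfrak{g}$ (this condition does not depend on the scaling of $B_{\mathfrak{m}}$). *)

(* Defs.v *)
From HB Require Import structures.
From mathcomp Require Import all_boot all_order all_algebra.
From mathcomp Require Import reals.
Set Implicit Arguments.
Unset Strict Implicit.
Unset Printing Implicit Defensive.
Import Order.TTheory GRing.Theory Num.Theory.
Local Open Scope ring_scope.

(* Lie algebras and representations.  Brackets and actions are bilinear maps;
   {dot V for idfun} is the library's type of positive definite symmetric
   bilinear forms. *)

Definition jacobi (g : zmodType) (br : g -> g -> g) : Prop :=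
  forall x y z, br x (br y z) + br y (br z x) + br z (br x y) = 0.

Definition is_lie_bracket (R : realType) (g : vectType R)
    (br : {bilinear g -> g -> g}) : Prop :=
  (forall x, br x x = 0) /\ jacobi br.

Definition ad_invariant (R : realType) (h : vectType R)
    (br : {bilinear h -> h -> h}) (B : {dot h for idfun}) : Prop :=
  forall a b c, B (br a b) c = - B b (br a c).

Section Representation.
Variables (R : realType) (h m : vectType R).
Implicit Types (br : {bilinear h -> h -> h}) (act : {bilinear h -> m -> m}).

Definition is_representation br act : Prop :=
  forall a b v, act (br a b) v = act a (act b v) - act b (act a v).

Definition faithful act : Prop :=
  forall a, (forall v, act a v = 0) -> a = 0.

Definition irreducible act : Prop :=
  (exists v : m, v != 0) /\
  forall U : {vspace m}, (forall a v, v \in U -> act a v \in U) ->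
    U = 0%VS \/ U = fullv.

Definition form_invariant act (B : {dot m for idfun}) : Prop :=
  forall a v w, B (act a v) w = - B v (act a w).

(* The bracket on h (+) m = h * m.  Nondegeneracy of Bh makes it unique. *)
Record is_s_bracket br (Bh : {dot h for idfun}) act (Bm : {dot m for idfun})
    (brg : {bilinear (h * m)%type -> (h * m)%type -> (h * m)%type}) : Prop := {
  s_bracket_skew : forall x y, brg x y = - brg y x;
  s_bracket_hh : forall a b, brg (a, 0) (b, 0) = (br a b, 0);
  s_bracket_hm : forall a v, brg (a, 0) (0, v) = (0, act a v);
  s_bracket_mm : forall v w, (brg (0, v) (0, w)).2 = 0;
  s_bracket_form : forall a v w,
    Bh a (brg (0, v) (0, w)).1 = Bm (act a v) w
}.

Definition s_representation br Bh act Bm : Prop :=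
  exists brg, is_s_bracket br Bh act Bm brg /\ is_lie_bracket brg.

End Representation.

(* Exterior powers, up to canonical isomorphism, by their universal property. *)

Definition upd (k : nat) (V : Type) (v : {ffun 'I_k -> V}) (i : 'I_k) (x : V) :
    {ffun 'I_k -> V} :=
  [ffun j => if j == i then x else v j].

Definition multilinear (R : nzRingType) (V F : lmodType R) (k : nat)
    (f : {ffun 'I_k -> V} -> F) : Prop :=
  forall v i, linear (fun x => f (upd v i x)).

Definition alternating (R : nzRingType) (V F : lmodType R) (k : nat)
    (f : {ffun 'I_k -> V} -> F) : Prop :=
  forall (v : {ffun 'I_k -> V}) (i j : 'I_k), i != j -> v i = v j -> f v = 0.

Definition is_exterior_power (R : nzRingType) (V L : lmodType R) (k : nat)
    (wedge : {ffun 'I_k -> V} -> L) : Prop :=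
  [/\ multilinear wedge, alternating wedge
    & forall (F : lmodType R) (f : {ffun 'I_k -> V} -> F),
        multilinear f -> alternating f ->
        exists2 g : {linear L -> F}, forall v, g (wedge v) = f v
        & forall g' : {linear L -> F},
            (forall v, g' (wedge v) = f v) -> g' =1 g].

(* a (v_1 /\ ... /\ v_k) = \sum_i v_1 /\ ... /\ a v_i /\ ... /\ v_k; this
   determines lact, because the v_1 /\ ... /\ v_k span L. *)
Definition is_induced_action (R : nzRingType) (h V L : lmodType R) (k : nat)
    (act : {bilinear h -> V -> V}) (wedge : {ffun 'I_k -> V} -> L)
    (lact : {bilinear h -> L -> L}) : Prop :=
  forall a v, lact a (wedge v) = \sum_(i < k) wedge (upd v i (act a (v i))).

(* Main.v *)
(** Let mu : m x m -> h be the bracket of m with itself, determined by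
    Bh a (mu v w) = Bm (a v) w.  The only Jacobi identity of h (+) m which is
    not formal is the one for three elements of m, and Bm turns its defect
    into the 4-form
      Bh (mu x y) (mu z t) + Bh (mu y z) (mu x t) + Bh (mu z x) (mu y t),
    which is alternating and h-invariant.  Through Bm it corresponds to an
    invariant element of the fourth exterior power of m; this element is zero
    by hypothesis, and evaluating the 4-form on it gives the sum of the squares
    of the coefficients of the form, so the form vanishes. *)

Require Import Defs.
From HB Require Import structures.
From mathcomp Require Import all_boot all_order all_algebra.
From mathcomp Require Import reals.
From mathcomp Require Import ring lra.
Set Implicit Arguments.
Unset Strict Implicit.
Unset Printing Implicit Defensive.
Import Order.TTheory GRing.Theory Num.Theory.
Local Open Scope ring_scope.

(** * Orthonormal bases of a Euclidean space *)

Section DotProduct.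
Variables (R : realType) (V : vectType R) (B : {dot V for idfun}).

Lemma dotC v w : B v w = B w v.
Proof. by rewrite hermC expr0 mul1r. Qed.

Lemma dot_eq0 v : B v v = 0 -> v = 0.
Proof.
move=> Bv0; apply/eqP; apply: contraT => v_neq0.
have : 0 < B v v by exact: neq0_dnorm_gt0.
by rewrite Bv0 ltxx.
Qed.

Lemma dot_inj v w : (forall u, B u v = B u w) -> v = w.
Proof.
move=> eqB; apply/eqP; rewrite -subr_eq0; apply/eqP/dot_eq0.
by rewrite linearBr /= eqB subrr.
Qed.

Definition orthonormal_family n (e : 'I_n -> V) :=
  forall i j, B (e i) (e j) = (i == j)%:R.

Definition in_expansion n (e : 'I_n -> V) (v : V) :=
  v = \sum_i B v (e i) *: e i.

(** Gram-Schmidt, by induction on [s]: the residue [y] of the new vector [x] is either zero, and the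
    family is kept, or normalised to [z] and added. *)
Lemma orthonormal_family_seq (s : seq V) :
  exists n (e : 'I_n -> V),
    orthonormal_family e /\ {in s, forall v, in_expansion e v}.
Proof.
elim: s => [|x s [n [e [eB es]]]].
  by exists 0, (fun=> 0); split=> // -[].
pose y := x - \sum_i B x (e i) *: e i.
have yB i : B y (e i) = 0.
  rewrite linearBl /= linear_sumlz (bigD1 i) //= big1 => [|j ji].
    by rewrite linearZl_LR /= eB eqxx mulr1 addr0 subrr.
  by rewrite linearZl_LR /= eB (negPf ji) mulr0.
have xE : x = y + \sum_i B x (e i) *: e i by rewrite /y subrK.
have [y0|y_neq0] := eqVneq y 0.
  exists n, e; split=> // v; rewrite inE => /predU1P[->|/es//].
  by rewrite /in_expansion {1}xE y0 add0r.
have y_gt0 : 0 < B y y by exact: neq0_dnorm_gt0.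
pose c := Num.sqrt (B y y).
have c_neq0 : c != 0 by rewrite gt_eqF // sqrtr_gt0.
have cc : c * c = B y y by rewrite -expr2 sqr_sqrtr // ltW.
pose z := c^-1 *: y.
have zB i : B z (e i) = 0 by rewrite linearZl_LR /= yB mulr0.
have zz : B z z = 1.
  by rewrite linearZl_LR linearZr_LR /= -cc mulKf // mulVf.
have yz : B y z *: z = y.
  by rewrite linearZr_LR /= scalerA -cc mulKf // divff ?scale1r.
(* [f] is the family [e] with [z] put in front, at index [ord0]. *)
pose f i := oapp e z (unlift ord0 i).
have f0 : f ord0 = z by rewrite /f unlift_none.
have fS i : f (lift ord0 i) = e i by rewrite /f liftK.
exists n.+1, f; split=> [i j|v].
  case: (unliftP ord0 i) => [i'|] ->; case: (unliftP ord0 j) => [j'|] ->;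
    rewrite ?f0 ?fS ?eB ?(inj_eq lift_inj) ?eqxx //.
  by rewrite dotC zB.
rewrite /in_expansion big_ord_recl f0 inE => /predU1P[->|/es ve].
  under eq_bigr do rewrite fS.
  rewrite {1}xE; congr (_ + _); rewrite -[LHS]yz; congr (_ *: _).
  apply/esym; rewrite {1}xE linearDl /= linear_sumlz big1 ?addr0 // => i _.
  by rewrite linearZl_LR /= (dotC _ z) zB mulr0.
under eq_bigr do rewrite fS.
rewrite -ve; suff -> : B v z = 0 by rewrite scale0r add0r.
rewrite ve linear_sumlz big1 // => i _.
by rewrite linearZl_LR /= (dotC _ z) zB mulr0.
Qed.

Lemma orthonormal_basis :
  exists n (e : 'I_n -> V),
    orthonormal_family e /\ forall v, in_expansion e v.
Proof.
have [n [e [eB es]]] := orthonormal_family_seq (vbasis {:V}).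
exists n, e; split=> // v; rewrite /in_expansion.
rewrite {1 2}(coord_vbasis (memvf v)).
under [RHS]eq_bigr do rewrite linear_sumlz scaler_suml.
rewrite exchange_big /=; apply: eq_bigr => i _.
rewrite {1}(es (vbasis {:V})`_i) ?mem_nth ?size_tuple //.
rewrite scaler_sumr; apply: eq_bigr => j _.
by rewrite linearZl_LR scalerA.
Qed.

End DotProduct.

(** * Multilinear maps evaluated on a spanning family *)

Section Multilinear.
Variables (R : nzRingType) (V F : lmodType R) (k : nat).
Variable f : {ffun 'I_k -> V} -> F.
Hypothesis mf : multilinear f.

Lemma upd_id (U : Type) (v : {ffun 'I_k -> U}) i : upd v i (v i) = v.
Proof. by apply/ffunP => j; rewrite ffunE; case: eqP => [->|]. Qed.

Lemma multilinear_sum v i (I : finType) (c : I -> R) (x : I -> V) :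
  f (upd v i (\sum_j c j *: x j)) = \sum_j c j *: f (upd v i (x j)).
Proof.
have f0 : f (upd v i 0) = 0.
  have := mf v i 1 0 0; rewrite scaler0 addr0 scale1r => /eqP.
  by rewrite -subr_eq subrr eq_sym => /eqP.
pose rel x y := f (upd v i x) = y.
apply: (big_ind2 rel) => // [x1 y1 x2 y2 | j _].
  by rewrite /rel => <- <-; have := mf v i 1 x1 x2; rewrite !scale1r.
by rewrite /rel; have := mf v i (c j) (x j) 0; rewrite f0 !addr0.
Qed.

Lemma multilinear_eq0 n (e : 'I_n -> V) :
  (forall v, exists c : 'I_n -> R, v = \sum_i c i *: e i) ->
  (forall g : {ffun 'I_k -> 'I_n}, f [ffun i => e (g i)] = 0) ->
  forall v, f v = 0.
Proof.
move=> span_e fe0.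
(* Only the entries before position [r] are arbitrary; the induction on [r] expands the entry at the
   last such position over [e]. *)
suff H r (v : {ffun 'I_k -> V}) :
    (forall i : 'I_k, r <= i -> exists p, v i = e p)%N -> f v = 0.
  by move=> v; apply: (H k) => i; rewrite leqNgt ltn_ord.
elim: r v => [|r IHr] v ve.
  have [g gE] := fin_all_exists (fun i => ve i (leq0n i)).
  by rewrite -[RHS](fe0 (finfun g)); congr f; apply/ffunP => i; rewrite !ffunE.
have [ltrk|lekr] := ltnP r k; last first.
  by apply: IHr => i /(leq_trans lekr); rewrite leqNgt ltn_ord.
pose i := Ordinal ltrk; have [c vi] := span_e (v i).
rewrite -(upd_id v i) vi multilinear_sum big1 // => p _.
rewrite IHr ?scaler0 // => j lerj; rewrite ffunE.
case: eqVneq => [_|/eqP ji]; first by exists p.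
by apply: ve; rewrite ltn_neqAle lerj andbT; apply/eqP => rj; apply/ji/val_inj.
Qed.

End Multilinear.

(** * From invariant forms to invariant multivectors *)

Section InvariantForm.
Variables (R : realType) (h V : vectType R) (L : lmodType R) (k : nat).
Variables (act : {bilinear h -> V -> V}) (B : {dot V for idfun}).
Variables (wedge : {ffun 'I_k -> V} -> L) (lact : {bilinear h -> L -> L}).
Variable f : {ffun 'I_k -> V} -> R^o.
Hypothesis B_inv : form_invariant act B.
Hypothesis wedge_ext : is_exterior_power wedge.
Hypothesis lactE : is_induced_action act wedge lact.
Hypothesis mf : multilinear f.
Hypothesis f_inv : forall a v, \sum_(i < k) f (upd v i (act a (v i))) = 0.

(* The multivector corresponding to f under B when e is orthonormal. *)
Definition dual_multivector n (e : 'I_n -> V) : L :=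
  \sum_(g : {ffun 'I_k -> 'I_n})
    f [ffun i => e (g i)] *: wedge [ffun i => e (g i)].

(** In the family [e] the action of [a] has a skew matrix [A]. Transposing it moves the action from
    the wedges to the coefficients, up to sign, where [f_inv] kills it. *)
Lemma dual_multivector_invariant n (e : 'I_n -> V) :
  (forall v, in_expansion B e v) ->
  forall a, lact a (dual_multivector e) = 0.
Proof.
move=> eE a; have [mw _ _] := wedge_ext.
pose E (g : {ffun 'I_k -> 'I_n}) : {ffun 'I_k -> V} := [ffun i => e (g i)].
have Eupd g i p : E (upd g i p) = upd (E g) i (e p).
  by apply/ffunP => j; rewrite !ffunE; case: eqP.
pose A p q := B (act a (e p)) (e q).
have AN p q : A p q = - A q p by rewrite /A B_inv dotC.
transitivity (\sum_i \sum_g \sum_q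
    (f (E g) * A (g i) q) *: wedge (E (upd g i q))).
  rewrite linear_sumr exchange_big /=; apply: eq_bigr => g _.
  rewrite linearZr_LR lactE scaler_sumr; apply: eq_bigr => i _.
  rewrite ffunE (eE (act a _)) multilinear_sum // scaler_sumr.
  by apply: eq_bigr => q _; rewrite Eupd scalerA.
transitivity (\sum_i \sum_g \sum_q
    (f (E (upd g i q)) * A q (g i)) *: wedge (E g)).
  apply: eq_bigr => i _; rewrite !pair_big /=.
  (* Exchanging the summation index q with the i-th index of g transposes
     the matrix of a. *)
  pose s (p : {ffun 'I_k -> 'I_n} * 'I_n) := (upd p.1 i p.2, p.1 i).
  have sK : involutive s.
    move=> [g q]; rewrite /s /= ffunE eqxx; congr (_, _).
    by apply/ffunP => j; rewrite !ffunE; case: eqP => // ->.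
  rewrite (reindex_inj (inv_inj sK)); apply: eq_bigr => -[g q] _ /=.
  by have /= [-> _] := sK (g, q); rewrite ffunE eqxx.
rewrite exchange_big big1 //= => g _.
under eq_bigr do rewrite -scaler_suml.
rewrite -scaler_suml -[RHS](scale0r (wedge (E g))); congr (_ *: _).
(* By skewness of [A], the opposite of this coefficient is the sum in [f_inv] at [E g]. *)
apply/eqP; rewrite -oppr_eq0 -sumrN; apply/eqP.
rewrite -[RHS](f_inv a (E g)); apply: eq_bigr => i _.
rewrite {2}/E ffunE (eE (act a _)) multilinear_sum // -sumrN.
by apply: eq_bigr => q _; rewrite Eupd AN mulrN opprK mulrC.
Qed.

Lemma invariant_form_eq0 :
  alternating f -> (forall x : L, (forall a, lact a x = 0) -> x = 0) ->
  forall v, f v = 0.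
Proof.
move=> af L_inv; have [n [e [_ eE]]] := orthonormal_basis B.
have [_ _ /(_ _ f mf af) [phi phiE _]] := wedge_ext.
apply: (multilinear_eq0 mf (e := e)) => [v|g].
  by exists (fun i => B v (e i)); apply: eE.
(* [phi] sends the dual multivector to the sum of the squares of the values [f (e \o g)], so each of
   these values is zero. *)
have := congr1 phi (L_inv _ (dual_multivector_invariant eE)).
rewrite linear0 linear_sum; under eq_bigr do rewrite linearZ /= phiE.
move/psumr_eq0P => /(_ (fun i _ => sqr_ge0 _)) /(_ g isT) /eqP.
by rewrite mulf_eq0 orbb => /eqP.
Qed.

End InvariantForm.

Lemma lie_bracketC (R : realType) (g : vectType R)
    (br : {bilinear g -> g -> g}) :
  is_lie_bracket br -> forall x y, br x y = - br y x.
Proof.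
move=> [br_alt _] x y; apply/eqP; rewrite -addr_eq0; apply/eqP.
by have := br_alt (x + y); rewrite linearDr !linearDl !br_alt add0r addr0 addrC.
Qed.

(** * The bracket on h (+) m and its Jacobi identity *)

Section SBracket.
Variables (R : realType) (h m : vectType R).
Variables (br : {bilinear h -> h -> h}) (Bh : {dot h for idfun}).
Variables (act : {bilinear h -> m -> m}) (Bm : {dot m for idfun}).

(** Riesz representation for [Bh]: the coordinates of [mu v w] in an orthonormal basis of h are the
    values of the functional on that basis. *)
Lemma moment_map_exists :
  exists mu : {bilinear m -> m -> h},
    forall a v w, Bh a (mu v w) = Bm (act a v) w.
Proof.
have [n [f [fB fE]]] := orthonormal_basis Bh.
pose mu v w := \sum_i Bm (act (f i) v) w *: f i.
have mu_bilinear : bilinear_for *:%R *:%R mu.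
  split=> [w|v] c x y /=; rewrite /mu scaler_sumr -big_split /=;
    apply: eq_bigr => i _.
    by rewrite linearPr linearPl /= scalerDl scalerA.
  by rewrite linearPr /= scalerDl scalerA.
pose mu_mixin := bilinear_isBilinear.Build _ _ _ _ _ _ mu mu_bilinear.
pose muB : {bilinear m -> m -> h} := HB.pack mu mu_mixin.
exists muB => a v w; rewrite [in RHS](fE a) /= /mu linear_sumr !linear_sumlz.
by apply: eq_bigr => i _; rewrite linearZr_LR !linearZl_LR /= mulrC.
Qed.

Variable mu : {bilinear m -> m -> h}.

Definition s_bracket (x y : h * m) : h * m :=
  (br x.1 y.1 + mu x.2 y.2, act x.1 y.2 - act y.1 x.2).

Lemma s_bracket_bilinear : bilinear_for *:%R *:%R s_bracket.
Proof.
split=> z c x y; rewrite /s_bracket; congr (_, _) => /=;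
  rewrite !(linearPl, linearPr) /= ?scalerDr ?scalerN ?opprD addrACA //.
Qed.

HB.instance Definition _ :=
  bilinear_isBilinear.Build _ _ _ _ _ _ s_bracket s_bracket_bilinear.

Hypothesis br_lie : is_lie_bracket br.
Hypothesis br_inv : ad_invariant br Bh.
Hypothesis act_rep : is_representation br act.
Hypothesis act_inv : form_invariant act Bm.
Hypothesis muE : forall a v w, Bh a (mu v w) = Bm (act a v) w.

Lemma mu_skew v w : mu v w = - mu w v.
Proof.
apply: (dot_inj (B := Bh)) => a; rewrite linearNr /= !muE act_inv.
by congr (- _); apply: dotC.
Qed.

(** This is the Jacobi identity for one element of h and two of m. Paired with [b], it follows from
    the invariance of both products and the action of the commutator of [a] and [b]. *)
Lemma mu_equivariant a v w : br a (mu v w) = mu (act a v) w + mu v (act a w).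
Proof.
apply: (dot_inj (B := Bh)) => b; rewrite linearDr /= !muE.
rewrite [LHS]dotC br_inv (dotC Bh) muE act_rep linearBl /= act_inv.
ring.
Qed.

(** It has the skewness and pair symmetry of a curvature tensor; the first Bianchi identity is what
    remains to be shown. *)
Definition moment_form x y z t : R := Bh (mu x y) (mu z t).

Lemma moment_formNl x y z t : moment_form x y z t = - moment_form y x z t.
Proof. by rewrite /moment_form mu_skew linearNl. Qed.

Lemma moment_formNr x y z t : moment_form x y z t = - moment_form x y t z.
Proof. by rewrite /moment_form (mu_skew z) linearNr. Qed.

Lemma moment_formC x y z t : moment_form x y z t = moment_form z t x y.
Proof. exact: dotC. Qed.

Lemma moment_form_invariant a x y z t :
  moment_form (act a x) y z t + moment_form x (act a y) z t
    + (moment_form x y (act a z) t + moment_form x y z (act a t)) = 0.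
Proof.
rewrite /moment_form -linearDl -linearDr /= -!mu_equivariant.
by rewrite br_inv addNr.
Qed.

(* Bm ([[x, y], z] + [[y, z], x] + [[z, x], y]) t *)
Definition jacobi_form (v : {ffun 'I_4 -> m}) : R^o :=
  let x := v (@Ordinal 4 0 isT) in let y := v (@Ordinal 4 1 isT) in
  let z := v (@Ordinal 4 2 isT) in let t := v (@Ordinal 4 3 isT) in
  moment_form x y z t + moment_form y z x t + moment_form z x y t.

Lemma jacobi_form_multilinear : multilinear jacobi_form.
Proof.
by move=> v [[|[|[|[|//]]]] lti] c x y; rewrite /jacobi_form !ffunE /=;
  rewrite /moment_form !(linearPl, linearPr) /=;
  rewrite -[_ *: _]/(_ * _); ring.
Qed.

(** When two arguments agree, one of the three terms vanishes by skewness and the other two cancel;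
    if [t] is among the equal ones, this also takes the pair symmetry. *)
Lemma jacobi_form_alternating : alternating jacobi_form.
Proof.
move=> v; rewrite /jacobi_form.
move=> [[|[|[|[|//]]]] lti] [[|[|[|[|//]]]] ltj] // _;
  rewrite (bool_irrelevance lti isT) (bool_irrelevance ltj isT).
all: move: (v _) (v _) (v _) (v _) => x y z t E; subst.
(* lra does not identify R^o with R. *)
all: change (@eq R^o) with (@eq R).
(* After substitution the repeated vector is [z]; the list serves all the positions it can
   occupy. *)
all: move: (moment_formNl z z y x) (moment_formNl z z x y)
  (moment_formNr y x z z) (moment_formNr x y z z)
  (moment_formNl z y z x) (moment_formNr z y z x) (moment_formC z y z x)
  (moment_formNl z y x z) (moment_formNl z x z y) (moment_formNr z x z y)
  (moment_formNl z x y z); lra.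
Qed.

(** The sum regroups into three instances of [moment_form_invariant], one for each cyclic
    permutation of [x], [y], [z]. *)
Lemma jacobi_form_invariant a v :
  \sum_(i < 4) jacobi_form (upd v i (act a (v i))) = 0.
Proof.
rewrite !big_ord_recl big_ord0 /jacobi_form !ffunE /=.
(* The iterated lifts left by [big_ord_recl] must match the literal indices of [jacobi_form]. *)
have -> : lift (@ord0 3) (lift (@ord0 2) (lift (@ord0 1) (@ord0 0))) =
  @Ordinal 4 3 isT by apply: val_inj.
have -> : lift (@ord0 3) (lift (@ord0 2) (@ord0 1)) = @Ordinal 4 2 isT.
  exact: val_inj.
have -> : lift (@ord0 3) (@ord0 2) = @Ordinal 4 1 isT by apply: val_inj.
have -> : @ord0 3 = @Ordinal 4 0 isT by apply: val_inj.
change (@eq R^o) with (@eq R).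
move: (v (@Ordinal 4 0 isT)) (v (@Ordinal 4 1 isT)) (v (@Ordinal 4 2 isT))
  (v (@Ordinal 4 3 isT)) => x y z t.
move: (moment_form_invariant a x y z t) (moment_form_invariant a y z x t)
  (moment_form_invariant a z x y t); lra.
Qed.

Lemma jacobi_form_eq0 :
  (forall v, jacobi_form v = 0) ->
  forall x y z, act (mu x y) z + act (mu y z) x + act (mu z x) y = 0.
Proof.
move=> f0 x y z; apply: (dot_inj (B := Bm)) => t; rewrite linear0r dotC.
have := f0 [ffun i : 'I_4 => nth 0 [:: x; y; z; t] i].
by rewrite /jacobi_form !ffunE /= /moment_form !muE !linearDl.
Qed.

Lemma s_bracket_lie :
  (forall v, jacobi_form v = 0) -> is_lie_bracket s_bracket.
Proof.
move=> /jacobi_form_eq0 mu_jacobi; have [br_alt br_jacobi] := br_lie.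
split=> [[a u]|[a u] [b v] [c w]]; apply: injective_projections => /=.
- rewrite br_alt add0r; apply: (dot_inj (B := Bh)) => d.
  by have := congr1 (Bh d) (mu_skew u u); rewrite linearNr linear0r /=; lra.
- by rewrite subrr.
(* The h-component: the Jacobi identity of h, and terms in one element of h and two of m that cancel
   by equivariance and skewness of [mu]. Pairing with [d] leaves real numbers for [lra]. *)
- apply: (dot_inj (B := Bh)) => d; have := congr1 (Bh d) (br_jacobi a b c).
  rewrite !(linearDr, linearNr) /= !mu_equivariant.
  rewrite (mu_skew u (act b w)) (mu_skew u (act c v)) (mu_skew v (act c u)).
  rewrite (mu_skew v (act a w)) (mu_skew w (act a v)) (mu_skew w (act b u)).
  rewrite !(linearDr, linearNr, linear0r) /=; lra.
(* The m-component: terms in two elements of h cancel by [act_rep], those in three elements of m by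
   [mu_jacobi]. *)
- apply: (dot_inj (B := Bm)) => t; have := congr1 (Bm t) (mu_jacobi u v w).
  rewrite !(linearDl, linearDr, linearNl, linearNr) /= !act_rep.
  rewrite !(linearDr, linearNr, linear0r) /=; lra.
Qed.

End SBracket.

Theorem corollary2p6 (R : realType) (h m : vectType R)
  (br : {bilinear h -> h -> h}) (Bh : {dot h for idfun})
  (act : {bilinear h -> m -> m}) (Bm : {dot m for idfun})
  (L : lmodType R) (wedge : {ffun 'I_4 -> m} -> L)
  (lact : {bilinear h -> L -> L}) :
  is_lie_bracket br -> ad_invariant br Bh ->
  is_representation br act -> faithful act -> irreducible act ->
  form_invariant act Bm ->
  is_exterior_power wedge -> is_induced_action act wedge lact ->
  (forall x : L, (forall a : h, lact a x = 0) -> x = 0) ->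
  s_representation br Bh act Bm.
Proof.
move=> br_lie br_inv act_rep _ _ act_inv wedge_ext lactE L_inv.
have [mu muE] := moment_map_exists Bh act Bm.
have lie_g : is_lie_bracket (s_bracket br act mu).
  apply: (s_bracket_lie br_lie br_inv act_rep act_inv muE).
  apply: (invariant_form_eq0 act_inv wedge_ext lactE) => //.
  - exact: jacobi_form_multilinear.
  - exact: jacobi_form_invariant br_inv act_rep act_inv muE.
  - exact: jacobi_form_alternating act_inv muE.
exists (s_bracket br act mu); split=> //.
split=> [x y|a b|a v|v w|a v w].
- exact: lie_bracketC lie_g x y.
- by rewrite /= /s_bracket /= !linear0r addr0 subrr.
- by rewrite /= /s_bracket /= !linear0l !linear0r addr0 subr0.
- by rewrite /= /s_bracket /= !linear0l subr0.
- by rewrite /= /s_bracket /= linear0l add0r.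
Qed.
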